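(* Let $T>0$, $I=[0,T]$, let $\kappa\in\mathscr{K}_{\mathrm{reg}}$ be a regular admissible kernel and let $\Lambda\in\mathscr{A}(I)$ be an adaptive sensitivity function. Let $f\in\mathcal{C}(I)$ be a non-zero function such that the maximum of $|f|$ is attained at some point of $(0,T]$, i.e. there exists $t^*\in(0,T]$ with $|f(t^* )|=\|f\|_\infty=\max_{t\in I}|f(t)|$. Then $$S_{\kappa,\Lambda}(f)>\|f\|_\infty.$$
   Context: Fix $T>0$ and $I=[0,T]$. $\mathcal{C}(I)$ is the set of continuous functions $I\to\mathbb{R}$ and $\|f\|_\infty:=\sup_{t\in I}|f(t)|$. Regular admissible kernels: $\mathscr{K}_{\mathrm{reg}}$ is the set of Lebesgue measurable, integrable functions $\kappa:I\to[0,\infty)$ such that (uniform boundedness) there are constants $0<m_\kappa\le M_\kappa<\infty$ with $m_\kappa\le\kappa(\tau)\le M_\kappa$ for all $\tau\in I$; (normalization) $\int_0^T\kappa(\tau)\,d\tau=1$; (Lipschitz continuity) there is $L_\kappa>0$ with $|\kappa(\tau_1)-\kappa(\tau_2)|\le L_\kappa|\tau_1-\tau_2|$ for all $\tau_1,\tau_2\in I$. Adaptive sensitivity functions: $\mathscr{A}(I)$ is the set of functions $\Lambda:I\times\mathbb{R}\to[0,\infty)$ such that: there are constants $0<\lambda_{\min}\le\lambda_{\max}<\infty$ with $\lambda_{\min}\le\Lambda(s,x)\le\lambda_{\max}$ for all $(s,x)\in I\times\mathbb{R}$; there is $L_\Lambda>0$ with $|\Lambda(s,x)-\Lambda(s,y)|\le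 L_\Lambda|x-y|$ for all $s\in I$, $x,y\in\mathbb{R}$; for every fixed $x\in\mathbb{R}$, $s\mapsto\Lambda(s,x)$ is Lebesgue measurable on $I$; there is $\varrho>0$ with $\Lambda(s,0)\ge\varrho$ for all $s\in I$. Adaptive memory-dependent functional: for $f\in\mathcal{C}(I)$, $$S_{\kappa,\Lambda}(f):=\sup_{t\in I}\left(|f(t)|+\int_0^t\Lambda(s,f(s))\,\kappa(t-s)\,|f(s)|\,ds\right).$$ *)

(* Defs.v *)
From mathcomp Require Import all_boot all_order all_algebra.
From mathcomp Require Import all_classical all_reals all_analysis.

Set Implicit Arguments.
Unset Strict Implicit.
Unset Printing Implicit Defensive.

Import Order.TTheory GRing.Theory Num.Theory.
Import numFieldNormedType.Exports.

Local Open Scope classical_set_scope.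
Local Open Scope ring_scope.

(* A function on [0, T] (resp. on [0, T] x R) is represented by a function on R
   (resp. R x R) of which only the values on [0, T] (resp. [0, T] x R) are ever
   constrained or used. *)

(* The real line with the Lebesgue (Caratheodory) sigma-algebra. The canonical
   measurable structure on R is the Borel one, which is too small here. *)
Definition lebesgueTypeR (R : realType) : measurableType _ :=
  caratheodory_type (mu_ext (@wlength R idfun)).

Definition lebesgue_measurable_fun (R : realType) (D : set R) (g : R -> R) : Prop :=
  @measurable_fun _ _ (lebesgueTypeR R) R D g.

Record regular_kernel (R : realType) (T : R) (kappa : R -> R) : Prop := {
  kernel_ge0 : forall tau, tau \in `[0, T]%R -> 0 <= kappa tau;
  kernel_measurable : lebesgue_measurable_fun `[0, T] kappa;
  kernel_integrable :
    completed_lebesgue_measure.-integrable `[0, T] (EFin \o kappa);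
  kernel_bounded : exists m M : R, [/\ 0 < m, m <= M &
    forall tau, tau \in `[0, T]%R -> m <= kappa tau <= M];
  kernel_normalized :
    \int[completed_lebesgue_measure]_(tau in `[0, T]) kappa tau = 1;
  kernel_lipschitz : exists2 L : R, 0 < L & L.-lipschitz_`[0, T] kappa }.

Record adaptive_sensitivity (R : realType) (T : R) (Lambda : R -> R -> R) :
    Prop := {
  sensitivity_ge0 : forall s x, s \in `[0, T]%R -> 0 <= Lambda s x;
  sensitivity_bounded : exists lmin lmax : R, [/\ 0 < lmin, lmin <= lmax &
    forall s x, s \in `[0, T]%R -> lmin <= Lambda s x <= lmax];
  sensitivity_lipschitz : exists2 L : R, 0 < L &
    forall s, s \in `[0, T]%R -> L.-lipschitz (Lambda s);
  sensitivity_measurable :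
    forall x, lebesgue_measurable_fun `[0, T] (Lambda ^~ x);
  sensitivity_at0 : exists2 rho : R, 0 < rho &
    forall s, s \in `[0, T]%R -> rho <= Lambda s 0 }.

Definition sup_norm (R : realType) (T : R) (f : R -> R) : R :=
  sup [set `|f t| | t in `[0, T]].

Definition memory_functional (R : realType) (T : R) (kappa : R -> R)
    (Lambda : R -> R -> R) (f : R -> R) : R :=
  sup [set `|f t| + \int[completed_lebesgue_measure]_(s in `[0, t])
                      (Lambda s (f s) * kappa (t - s) * `|f s|)
      | t in `[0, T]].

(* Main.v *)
Require Import Defs.
From mathcomp Require Import all_boot all_order all_algebra.
From mathcomp Require Import all_classical all_reals all_analysis.
Import Order.TTheory GRing.Theory Num.Theory.
Import numFieldNormedType.Exports.

(** The functional at a time [t] exceeds [`|f t|] by the memory integral over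
    [[0, t]], so it is enough that this integral be positive at a maximizer [t]
    of [`|f|]: the supremum then exceeds the value [`|f t| = sup_norm T f].

    Positivity comes from continuity. Since [f] is not zero, [sup_norm T f] is
    positive, and since [0 < t] there is an interval [[a, t]] of positive length
    inside [[0, t]] on which [`|f|] stays above half of its maximum
    ([norm_gt_left_itv]). There the integrand is at least
    [lmin * m * (sup_norm T f / 2)], because the sensitivity and the kernel are
    bounded below by positive constants, so [Rintegral_itvcc_ge] applies.

    A real supremum bounds the values of a set from above only when the set has
    an upper bound, and a real-valued integral respects the order only where the
    extended one is finite. Both facts follow from the upper bounds on
    the sensitivity, the kernel and [`|f|] ([le_sup_norm], [integral_itvcc_le]).

    All integrals, including that of the composite [s |-> Lambda s (f s)], are
    compared directly through the simple functions below their integrands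
    ([ge0_le_integral_set]). *)

Set Implicit Arguments.
Unset Strict Implicit.
Unset Printing Implicit Defensive.
Local Open Scope classical_set_scope.
Local Open Scope ring_scope.

(** The integral of a nonnegative function, measurable or not, is the supremum
    of the integrals of the simple functions below it, and enlarging the function
    (or its domain) enlarges that family of simple functions. *)
Lemma ge0_le_integral_set (d : measure_display) (X : measurableType d)
    (R : realType) (mu : {measure set X -> \bar R}) (D E : set X)
    (g h : X -> \bar R) :
  (forall x, D x -> 0 <= g x)%E -> (forall x, E x -> 0 <= h x)%E ->
  (forall x, D x -> E x /\ (g x <= h x)%E) ->
  (\int[mu]_(x in D) g x <= \int[mu]_(x in E) h x)%E.
Proof.
move=> g0 h0 gh; rewrite !ge0_integralE//.
apply: ge_ereal_sup => _ [s sg <-]; apply: ereal_sup_ubound.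
exists s => //= x; apply: (le_trans (sg x)).
rewrite !patchE; case: ifPn => [|_].
  by rewrite inE => /gh[Ex ghx]; rewrite mem_set.
by case: ifPn => //; rewrite inE => /h0.
Qed.

Lemma measurable_itvcc_lebesgue (R : realType) (a b : R) :
  @measurable _ (lebesgueTypeR R) `[a, b].
Proof. by apply: sub_caratheodory; exact: measurable_itv. Qed.

(** The Lebesgue measure and its completion are the same outer measure, on two
    different sigma-algebras, so that the known value carries over by
    conversion. *)
Lemma completed_lebesgue_measure_itvcc (R : realType) (a b : R) : a <= b ->
  completed_lebesgue_measure (`[a, b] : set R) = (b - a)%:E.
Proof.
move=> ab; have := lebesgue_measure_itv `[a, b].
rewrite /= lte_fin.
have [altb|blea] := ltP a b; first exact.
have /eqP -> : a == b by rewrite eq_le ab.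
by rewrite subrr.
Qed.

Lemma integral_cst_itvcc (R : realType) (a b c : R) : a <= b ->
  (\int[completed_lebesgue_measure]_(s in `[a, b]) c%:E = (c * (b - a))%:E)%E.
Proof.
move=> ab; rewrite integral_cst; last exact: measurable_itvcc_lebesgue.
by rewrite EFinM -(completed_lebesgue_measure_itvcc ab).
Qed.

Lemma integral_itvcc_le (R : realType) (t C : R) (g : R -> R) : 0 <= t ->
  (forall s, s \in `[0, t]%R -> 0 <= g s <= C) ->
  (\int[completed_lebesgue_measure]_(s in `[0%R, t]) (g s)%:E <=
   (C * t)%:E)%E.
Proof.
move=> t0 gC.
apply: (@le_trans _ _
    (\int[completed_lebesgue_measure]_(s in `[0%R, t]) C%:E)%E).
  apply: ge0_le_integral_set => s /= st; have /andP[g0 gC'] := gC s st.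
  - by rewrite lee_fin.
  - by rewrite lee_fin (le_trans g0).
  - by rewrite lee_fin.
by rewrite integral_cst_itvcc// subr0.
Qed.

(** Needed to pass from the extended integral to its real value, since [fine]
    would send an infinite integral to [0]. *)
Lemma integral_itvcc_fin_num (R : realType) (t C : R) (g : R -> R) : 0 <= t ->
  (forall s, s \in `[0, t]%R -> 0 <= g s <= C) ->
  (\int[completed_lebesgue_measure]_(s in `[0%R, t]) (g s)%:E)%E
    \is a fin_num.
Proof.
move=> t0 gC; rewrite ge0_fin_numE.
  by rewrite (le_lt_trans (integral_itvcc_le t0 gC))// ltry.
by apply: integral_ge0 => s /= /gC /andP[]; rewrite lee_fin.
Qed.

Lemma Rintegral_itvcc_le (R : realType) (t C : R) (g : R -> R) : 0 <= t ->
  (forall s, s \in `[0, t]%R -> 0 <= g s <= C) ->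
  \int[completed_lebesgue_measure]_(s in `[0, t]) g s <= C * t.
Proof.
move=> t0 gC; rewrite -lee_fin fineK ?integral_itvcc_le//.
exact: integral_itvcc_fin_num gC.
Qed.

Lemma Rintegral_itvcc_ge (R : realType) (a t c C : R) (g : R -> R) :
  0 <= a -> a <= t -> 0 <= c ->
  (forall s, s \in `[0, t]%R -> 0 <= g s <= C) ->
  (forall s, s \in `[a, t]%R -> c <= g s) ->
  c * (t - a) <= \int[completed_lebesgue_measure]_(s in `[0, t]) g s.
Proof.
move=> a0 leat c0 gC cg; have t0 := le_trans a0 leat.
rewrite -lee_fin fineK; last exact: integral_itvcc_fin_num gC.
rewrite -integral_cst_itvcc//.
apply: ge0_le_integral_set => s /= sI.
- by rewrite lee_fin.
- by rewrite lee_fin; have /andP[] := gC s sI.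
- split; last by rewrite lee_fin cg.
  by move: sI; rewrite !in_itv/= => /andP[/(le_trans a0)->].
Qed.

(** By compactness of [[0, T]] the supremum is taken over a bounded set, so that
    it is an upper bound. *)
Lemma le_sup_norm (R : realType) (T : R) (f : R -> R) :
  {within `[0, T], continuous f} ->
  forall s, s \in `[0, T]%R -> `|f s| <= sup_norm T f.
Proof.
move=> cf s sT.
have [N [_ fN]] : bounded_set (f @` `[0, T]).
  by apply: compact_bounded; apply: continuous_compact cf _; exact: segment_compact.
apply: ub_le_sup; last by exists s.
exists (N + 1) => _ [r rT <-].
by apply: (fN (N + 1)); rewrite ?ltrDl//; exists r.
Qed.

(** The interval is taken to the left of [t] because only times before [t] enter
    the memory integral at [t]. Here [0 < t] gives it a positive length. *)
Lemma norm_gt_left_itv (R : realType) (T t c : R) (f : R -> R) :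
  {within `[0, T], continuous f} -> t \in `]0, T]%R -> c < `|f t| ->
  exists2 a, 0 <= a < t & forall s, s \in `[a, t]%R -> c < `|f s|.
Proof.
move=> cf; rewrite in_itv/= => /andP[t0 tT] cft.
have tI : `[0, T]%classic t by rewrite /= in_itv/= (ltW t0).
have : f @ within `[0, T] (nbhs t) --> f t.
  by move/subspace_continuousP: cf; exact.
move=> /cvgr_norm_gt /(_ _ cft); rewrite near_withinE => -[e /= e0 ef].
(* Half of the radius [e], because the ball is open and [a] has to lie in it. *)
exists (Num.max 0 (t - e / 2)).
  by rewrite le_max lexx/= gt_max t0/= ltrBlDr ltrDl divr_gt0.
move=> s; rewrite in_itv/= ge_max => /andP[/andP[s0 tes] st].
apply: ef; last by rewrite /= in_itv/= s0 (le_trans st).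
rewrite /ball_/= ger0_norm ?subr_ge0//.
rewrite (@le_lt_trans _ _ (e / 2))//; first by rewrite lerBlDr -lerBlDl.
by rewrite gtr_pMr// invf_lt1 ?ltr1n.
Qed.

Theorem theorem4p1 (R : realType) (T : R) (hT : 0 < T)
  (kappa : R -> R) (hkappa : regular_kernel T kappa)
  (Lambda : R -> R -> R) (hLambda : adaptive_sensitivity T Lambda)
  (f : R -> R) (hf : {within `[0, T], continuous f})
  (hf0 : exists2 t, t \in `[0, T]%R & f t != 0)
  (hmax : exists2 t, t \in `]0, T]%R & `|f t| = sup_norm T f) :
  sup_norm T f < memory_functional T kappa Lambda f.
Proof.
have [m [M [m0 _ kmM]]] := kernel_bounded hkappa.
have [lmin [lmax [l0 _ Lll]]] := sensitivity_bounded hLambda.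
have [t0 t0T ft0] := hf0.
have N0 : 0 < sup_norm T f.
  by rewrite (lt_le_trans _ (le_sup_norm hf t0T))// normr_gt0.
have [t tT ftN] := hmax.
have [a /andP[a0 leat] fa] : exists2 a, 0 <= a < t &
    forall s, s \in `[a, t]%R -> sup_norm T f / 2 < `|f s|.
  apply: (norm_gt_left_itv hf tT).
  by rewrite ftN gtr_pMr// invf_lt1 ?ltr1n.
have bnd u s : u \in `[0, T]%R -> s \in `[0, u]%R ->
    [/\ s \in `[0, T]%R, m <= kappa (u - s) <= M & lmin <= Lambda s (f s) <= lmax].
  rewrite !in_itv/= => /andP[u0 uT] /andP[s0 su].
  have sT : s \in `[0, T]%R by rewrite in_itv/= s0 (le_trans su).
  split=> //; last exact: Lll.
  by apply: kmM; rewrite in_itv/= subr_ge0 su (le_trans _ uT)// lerBlDr lerDl.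
pose C := lmax * M * sup_norm T f.
have gC u : u \in `[0, T]%R -> forall s, s \in `[0, u]%R ->
    0 <= Lambda s (f s) * kappa (u - s) * `|f s| <= C.
  move=> uT s su; have [sT /andP[mk kM] /andP[lL Ll]] := bnd _ _ uT su.
  have k0 : 0 <= kappa (u - s) by rewrite (le_trans (ltW m0)).
  have L0 : 0 <= Lambda s (f s) by rewrite (le_trans (ltW l0)).
  by rewrite !mulr_ge0//= !ler_pM ?mulr_ge0// le_sup_norm.
have tT' : t \in `[0, T]%R.
  by move: tT; rewrite !in_itv/= => /andP[/ltW-> ->].
have C0 : 0 <= C.
  have /andP[] : 0 <= Lambda 0 (f 0) * kappa (0 - 0) * `|f 0| <= C.
    by apply: gC; rewrite in_itv/= lexx// ltW.
  exact: le_trans.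
apply: (@lt_le_trans _ _ (`|f t| +
    \int[completed_lebesgue_measure]_(s in `[0, t])
      (Lambda s (f s) * kappa (t - s) * `|f s|))).
  rewrite ftN ltrDl.
  apply: (@lt_le_trans _ _ (lmin * m * (sup_norm T f / 2) * (t - a))).
    by rewrite !mulr_gt0 ?subr_gt0.
  apply: (Rintegral_itvcc_ge a0 (ltW leat) _ (gC t tT')).
    by rewrite !mulr_ge0 ?ltW.
  move=> s sat; have st : s \in `[0, t]%R.
    by move: sat; rewrite !in_itv/= => /andP[/(le_trans a0)->].
  have [_ /andP[mk _] /andP[lL _]] := bnd _ _ tT' st.
  by rewrite !ler_pM ?mulr_ge0 ?(ltW l0) ?(ltW m0) ?(ltW N0) ?(ltW (fa s sat)).
(* The same bound [C] on the integrand for all times makes the set bounded. *)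
apply: ub_le_sup; last by exists t.
exists (sup_norm T f + C * T) => _ [u uT <-].
move: (uT); rewrite /= in_itv/= => /andP[u0 u_T].
rewrite lerD ?le_sup_norm//.
by rewrite (le_trans (Rintegral_itvcc_le u0 (gC u uT)))// ler_wpM2l.
Qed.
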